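(* Suppose that $1<p<2$ and let $k\ge2$ be an integer. Then, for any network $G=(V,E,A)$ such that the maximum size of a clique contained in $G$ is $k$, $$\lambda_1(A)\le\phi_{\frac{p}{2(p-1)}}(k)^{\frac{p-1}{p}}\,\|A\|_p.$$ In the case $0<p\le1$, for any network $G=(V,E,A)$, $$\lambda_1(A)\le2^{-\frac1p}\,\|A\|_p.$$
   Context: A network $G=(V,E,A)$ is a finite simple undirected graph $(V,E)$ together with a conductance matrix $A=(a_{ij})_{i,j\in V}$: a real symmetric matrix with $a_{ij}=0$ unless $i$ and $j$ are joined by an edge of $E$ (in particular, zero diagonal); $a_{ij}$ is the weight of the edge joining $i,j$. $\lambda_1(A)$ denotes the largest eigenvalue of $A$. For $p>0$, $\|A\|_p:=\big(\sum_{i,j}|a_{ij}|^p\big)^{1/p}$ is the entrywise $L^p$-(quasi)norm. For $\theta>1$ and an integer $k\ge2$, $\phi_\theta(k):=\sup_{f=(f_1,\dots,f_k)\in\mathbb R^k,\ \|f\|_1=1}\ \sum_{i,j\in[k],\,i\ne j}|f_i|^\theta|f_j|^\theta$ (sum over ordered pairs), where $[k]=\{1,\dots,k\}$. *)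

(* Defs.v *)
From HB Require Import structures.
From mathcomp Require Import all_boot all_order all_algebra.
From mathcomp Require Import all_classical all_reals all_analysis.

Set Implicit Arguments.
Unset Strict Implicit.
Unset Printing Implicit Defensive.

Import Order.TTheory GRing.Theory Num.Theory.

Local Open Scope classical_set_scope.
Local Open Scope ring_scope.

Record network (R : realType) := Network {
  vertex : finType ;
  edge : rel vertex ;
  edge_sym : symmetric edge ;
  edge_irr : irreflexive edge ;
  conductance : vertex -> vertex -> R ;
  conductance_sym : forall x y, conductance x y = conductance y x ;
  conductance_edge : forall x y, ~~ edge x y -> conductance x y = 0 }.

(* MathComp matrices are indexed by ordinals, so the vertices are listed in the
   order of their canonical enumeration. *)
Definition conductance_mx (R : realType) (G : network R) :
    'M[R]_#|vertex G| :=
  \matrix_(i, j) conductance (enum_val i) (enum_val j).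

Definition is_clique (R : realType) (G : network R) (C : {set vertex G}) : bool :=
  [forall x in C, forall y in C, (x != y) ==> edge x y].

Definition clique_number (R : realType) (G : network R) : nat :=
  \max_(C : {set vertex G} | is_clique C) #|C|.

(* A matrix has finitely many eigenvalues, so the supremum is the largest real
   eigenvalue as soon as there is one, which is the case for symmetric matrices
   of positive size. It is 0 for the empty matrix. *)
Definition lambda1 (R : realType) (n : nat) (A : 'M[R]_n) : R :=
  sup [set a : R | eigenvalue A a].

Definition lp_norm (R : realType) (m n : nat) (p : R) (A : 'M[R]_(m, n)) : R :=
  (\sum_(i < m) \sum_(j < n) `|A i j| `^ p) `^ (1 / p).

Definition phi (R : realType) (theta : R) (k : nat) : R :=
  sup [set \sum_(i < k) \sum_(j < k | i != j)
             `|f ord0 i| `^ theta * `|f ord0 j| `^ theta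
      | f in [set f : 'rV[R]_k | \sum_(i < k) `|f ord0 i| = 1]].

(* Main.v *)
Require Import Defs.
From HB Require Import structures.
From mathcomp Require Import all_boot all_order all_algebra.
From mathcomp Require Import all_classical all_reals all_analysis.
From mathcomp Require Import ring lra.

Set Implicit Arguments.
Unset Strict Implicit.
Unset Printing Implicit Defensive.

Import Order.TTheory GRing.Theory Num.Theory.

Local Open Scope ring_scope.

(** Both bounds start from the quadratic form: for a unit eigenvector [x],
    [lambda <= \sum_(i, j) |a_ij| |x_i| |x_j|] ([lambda1_le]).

    For [1 < p < 2], let [q = p / (p - 1)] be the conjugate exponent and
    [t = q / 2 = p / (2 (p - 1)) > 1].  Hoelder's inequality over the ordered
    pairs of adjacent vertices ([hoelder_sum]) bounds the form by [||A||_p]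
    times the [q]-th root of [\sum_(i ~ j) f_i^t f_j^t], where [f_i = x_i^2]
    has total mass 1.  What remains is an analogue of the Motzkin-Straus
    theorem, [edge_form_le_phi]: that sum is at most [phi t k] as soon as no
    clique has more than [k] vertices.  If two vertices [u], [v] of the support
    of [f] are not adjacent, the sum depends on [f_u], [f_v] only through
    [2 (f_u^t P + f_v^t Q)], where [P], [Q] come from the other vertices.
    Since [f_u^t + f_v^t <= (f_u + f_v)^t], moving the whole mass to the vertex
    with the larger coefficient does not decrease the sum, and it shrinks the
    support ([edge_form_shift]).  After finitely many moves the support is a
    clique, hence has at most [k] vertices, and [f] is, up to zero entries, a
    competitor in the supremum defining [phi t k] ([edge_form_le_phi_small]).

    For [0 < p <= 1], off-diagonal products satisfy [|x_i| |x_j| <= 1/2], so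
    [lambda <= (\sum_(i, j) |a_ij|) / 2]; this sum, taken once per edge, is at
    most the [l^p] quasinorm of the edge weights, i.e. [2^(-1/p) ||A||_p]
    because each edge is counted twice in [||A||_p] ([sum_le_lp_sum]). *)

(** * Power inequalities *)

(** Young's inequality applied termwise after both families are normalised; a
    family of norm 0 vanishes identically. *)
Lemma hoelder_sum (R : realType) (I : finType) (p q : R) (u v : I -> R) :
  0 < p -> 0 < q -> p^-1 + q^-1 = 1 ->
  (forall i, 0 <= u i) -> (forall i, 0 <= v i) ->
  \sum_i u i * v i <=
    (\sum_i u i `^ p) `^ p^-1 * (\sum_i v i `^ q) `^ q^-1.
Proof.
move=> p0 q0 pq u0 v0.
have sum_eq0 (r : R) (w : I -> R) : 0 < r ->
    \sum_i w i `^ r = 0 -> forall i, w i = 0.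
  move=> r0 w0 i; apply: (@powR_eq0_eq0 R _ r).
  by apply: (psumr_eq0P _ w0) => // j _; exact: powR_ge0.
have [U0|Un0] := eqVneq (\sum_i u i `^ p) 0.
  rewrite big1 => [|i _]; first by rewrite mulr_ge0 ?powR_ge0.
  by rewrite (sum_eq0 _ _ p0 U0) mul0r.
have [V0|Vn0] := eqVneq (\sum_i v i `^ q) 0.
  rewrite big1 => [|i _]; first by rewrite mulr_ge0 ?powR_ge0.
  by rewrite (sum_eq0 _ _ q0 V0) mulr0.
have Ugt0 : 0 < \sum_i u i `^ p.
  by rewrite lt0r Un0 sumr_ge0 // => i _; exact: powR_ge0.
have Vgt0 : 0 < \sum_i v i `^ q.
  by rewrite lt0r Vn0 sumr_ge0 // => i _; exact: powR_ge0.
set U := \sum_i u i `^ p in Ugt0 *; set V := \sum_i v i `^ q in Vgt0 *.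
have Up : 0 < U `^ p^-1 by exact: powR_gt0.
have Vq : 0 < V `^ q^-1 by exact: powR_gt0.
have split1 : 1 = \sum_i (u i `^ p / U / p + v i `^ q / V / q).
  rewrite big_split /= -!mulr_suml -/U -/V.
  by rewrite !divff ?gt_eqF // !mul1r.
have UV0 : 0 < U `^ p^-1 * V `^ q^-1 by exact: mulr_gt0.
rewrite -[leRHS]mulr1 -(ler_pdivrMl _ _ UV0) mulr_sumr [leRHS]split1.
clearbody U V.
apply: ler_sum => i _.
have unscale (r W w : R) : 0 < r -> 0 < W -> 0 <= w ->
    (w / W `^ r^-1) `^ r = w `^ r / W.
  move=> r0 W0 w0; rewrite powRM ?invr_ge0 ?powR_ge0 //; congr (_ * _).
  rewrite -powR_inv1 ?powR_ge0 // -!powRrM mulN1r mulrN mulVf ?gt_eqF //.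
  by rewrite powR_inv1 // ltW.
rewrite -(unscale p) // -(unscale q) //.
apply: le_trans (conjugate_powR _ _ p0 q0 pq); last 2 first.
- by rewrite divr_ge0 ?powR_ge0.
- by rewrite divr_ge0 ?powR_ge0.
by rewrite invfM mulrACA ![_^-1 * _]mulrC.
Qed.

(** For [c <= a + b], the ratio [c / (a + b)] is at most 1, so its [t]-th power
    is at most itself; the two ratios add up to 1. *)
Lemma powR_superadd (R : realType) (t a b : R) :
  1 <= t -> 0 <= a -> 0 <= b -> a `^ t + b `^ t <= (a + b) `^ t.
Proof.
move=> t1 a0 b0.
have t_neq0 : t != 0 by lra.
have [ab0|ab_neq0] := eqVneq (a + b) 0.
  have -> : a = 0 by lra.
  have -> : b = 0 by lra.
  by rewrite addr0 powR0 // addr0.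
have ab_gt0 : 0 < a + b by rewrite lt0r ab_neq0 addr_ge0.
have share c : 0 <= c -> c <= a + b ->
    c `^ t <= c / (a + b) * (a + b) `^ t.
  rewrite le0r => /predU1P[-> _|c0 cab]; first by rewrite powR0 // !mul0r.
  rewrite -{1}[c](divfK ab_neq0); apply: ge1r_powRZ => //; last exact: ltW.
  by rewrite divr_gt0 //= ler_pdivrMr // mul1r.
have := lerD (share a a0 _) (share b b0 _).
rewrite -!mulrDl divff // mul1r; apply; lra.
Qed.

(** * A Motzkin-Straus inequality for powers *)

Definition edge_form (R : realType) (T : finType) (e : rel T) (F : T -> R) : R :=
  \sum_x \sum_(y | e x y) F x * F y.

(** The supremum defining [phi] is over a bounded set, since every [|f_i|] is at
    most 1; a real [sup] says nothing otherwise. *)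
Lemma phi_ub (R : realType) (t : R) (k : nat) (h : 'I_k -> R) :
  0 <= t -> (forall i, 0 <= h i) -> \sum_i h i = 1 ->
  \sum_(i < k) \sum_(j < k | i != j) h i `^ t * h j `^ t <= phi t k.
Proof.
move=> t0 h0 h1; apply: ub_le_sup.
  exists (\sum_(i < k) \sum_(j < k | i != j) 1) => _ [f /= f1 <-].
  have f_le1 i : `|f ord0 i| `^ t <= 1.
    have <- : 1 `^ t = 1 :> R by rewrite powR1.
    apply: ge0_ler_powR; rewrite ?nnegrE //.
    by rewrite -f1 (bigD1 i) //= lerDl sumr_ge0.
  apply: ler_sum => i _; apply: ler_sum => j _.
  by rewrite -[leRHS]mulr1 ler_pM ?powR_ge0.
exists (\row_i h i) => /=.
  by rewrite -[RHS]h1; apply: eq_bigr => i _; rewrite mxE ger0_norm.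
apply: eq_bigr => i _; apply: eq_bigr => j _.
by rewrite !mxE !ger0_norm.
Qed.

(** Listing the support and padding with zeros turns [f] into a competitor for
    [phi t k]; irreflexivity gives [i != j] on every edge, so the edge terms are
    among the terms of [phi]. *)
Lemma edge_form_le_phi_small (R : realType) (T : finType) (e : rel T) (t : R)
    (k : nat) (f : T -> R) :
  irreflexive e -> 0 < t -> (forall x, 0 <= f x) -> \sum_x f x = 1 ->
  (#|[set x | f x != 0%R]| <= k)%N ->
  edge_form e (fun x => f x `^ t) <= phi t k.
Proof.
move=> e_irr t0 f0 f1; set S := [set x | f x != 0] => Sk.
have f_out x : x \notin S -> f x = 0 by rewrite inE negbK => /eqP.
have /set0Pn[x0 x0S] : S != finset.set0.
  apply: contra_eq_neq f1 => S0; rewrite big1 ?(eq_sym 0) ?oner_eq0 // => x _.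
  by rewrite f_out // S0 inE.
(* [nth] with default 0 pads the list of values of [f] on its support. *)
pose s := enum S.
have size_s : size s = #|S| by rewrite -cardE.
pose h (i : nat) := nth 0 (map f s) i.
have h_out i : (size s <= i)%N -> h i = 0.
  by move=> si; rewrite /h nth_default // size_map.
have h_in i : (i < size s)%N -> h i = f (nth x0 s i).
  by move=> si; rewrite /h (nth_map x0).
have h0 i : 0 <= h i.
  by case: (ltnP i (size s)) => si; [rewrite h_in | rewrite h_out].
have widen (F : nat -> R) : (forall i, (size s <= i)%N -> F i = 0) ->
    \sum_(i < k) F i = \sum_(i < size s) F i.
  move=> F0; rewrite [RHS](big_ord_widen k F) ?size_s //.
  rewrite [LHS](bigID (fun i : 'I_k => i < #|S|)%N) /= [X in _ + X]big1 ?addr0 //.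
  by move=> i; rewrite -leqNgt -size_s => /F0.
have support_sum (F : T -> R) : (forall x, x \notin S -> F x = 0) ->
    \sum_x F x = \sum_(i < size s) F (nth x0 s i).
  move=> F0; rewrite (bigID (mem S)) /= [X in _ + X]big1 ?addr0 //.
  by rewrite -big_enum /= (big_nth x0) big_mkord.
have t_neq0 : t != 0 by rewrite gt_eqF.
apply: le_trans (phi_ub (h := fun i : 'I_k => h i) (ltW t0) _ _) => //; last first.
  rewrite widen // -[RHS]f1 support_sum; last by move=> x /f_out.
  by apply: eq_bigr => i _; rewrite h_in.
pose G (i : nat) := \sum_(j < k | i != j) h i `^ t * h j `^ t.
rewrite (widen G); last first.
  by move=> i si; rewrite /G big1 // => j _; rewrite h_out // powR0 // mul0r.
rewrite /edge_form support_sum; last first.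
  by move=> x /f_out fx; rewrite big1 // => y _; rewrite fx powR0 // mul0r.
apply: ler_sum => i _; rewrite /G.
rewrite big_mkcond support_sum; last first.
  by move=> x /f_out fx; rewrite fx powR0 // mulr0 if_same.
rewrite [leRHS]big_mkcond.
rewrite (widen (fun j => if (i : nat) != j then h i `^ t * h j `^ t else 0)).
  apply: ler_sum => j _; rewrite !h_in //.
  case: ifP => [eij|_]; last by case: ifP; rewrite // mulr_ge0 ?powR_ge0.
  by case: eqP eij => [->|//]; rewrite e_irr.
by move=> j sj; rewrite (h_out j) // powR0 // mulr0 if_same.
Qed.

(** The quadratic term of the expansion vanishes: [F' - F] lives on [u], [v], and
    neither of the pairs [(u, v)], [(u, u)], [(v, v)] is an edge. *)
Lemma edge_form_perturb (R : realType) (T : finType) (e : rel T) (F F' : T -> R)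
    (u v : T) :
  symmetric e -> irreflexive e -> u != v -> ~~ e u v ->
  (forall x, x != u -> x != v -> F' x = F x) ->
  edge_form e F' = edge_form e F
    + ((F' u - F u) * (\sum_(y | e u y) F y)
       + (F' v - F v) * (\sum_(y | e v y) F y)) *+ 2.
Proof.
move=> e_sym e_irr uv euv FF'.
pose D x := F' x - F x.
have D0 x : x != u -> x != v -> D x = 0.
  by move=> xu xv; rewrite /D FF' // subrr.
have sumD (c : T -> R) : \sum_x D x * c x = D u * c u + D v * c v.
  rewrite (bigD1 u) //= (bigD1 v) 1?eq_sym //= big1 ?addr0 //.
  by move=> x /andP[xu xv]; rewrite D0 // mul0r.
have DD x y : e x y -> D x * D y = 0.
  move=> exy; case: (boolP ((x == u) || (x == v))) => [|]; last first.
    by rewrite negb_or => /andP[xu xv]; rewrite D0 // mul0r.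
  case: (boolP ((y == u) || (y == v))) => [|]; last first.
    by rewrite negb_or => /andP[yu yv]; rewrite (D0 y) // mulr0.
  by move=> /orP[]/eqP yE /orP[]/eqP xE; move: exy euv;
    rewrite xE yE ?e_irr // e_sym => ->.
have cross : \sum_x \sum_(y | e x y) F x * D y
           = \sum_x \sum_(y | e x y) D x * F y.
  under eq_bigr do rewrite big_mkcond.
  rewrite exchange_big /=; apply: eq_bigr => x _; rewrite [RHS]big_mkcond.
  by apply: eq_bigr => y _; rewrite e_sym mulrC.
have -> : edge_form e F' = edge_form e F
    + \sum_x \sum_(y | e x y) D x * F y + \sum_x \sum_(y | e x y) F x * D y.
  rewrite /edge_form -!big_split; apply: eq_bigr => x _ /=.
  rewrite -!big_split; apply: eq_bigr => y exy /=.
  by have := DD x y exy; rewrite /D; lra.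
rewrite cross -addrA -mulr2n -(sumD (fun x => \sum_(y | e x y) F y)).
by under eq_bigr do rewrite -mulr_sumr.
Qed.

(** Superadditivity pays for the mass lost at [v] with the mass gained at [u],
    whose coefficient is at least as large. *)
Lemma edge_form_shift (R : realType) (T : finType) (e : rel T) (t : R)
    (f : T -> R) (u v : T) :
  symmetric e -> irreflexive e -> 1 <= t -> (forall x, 0 <= f x) ->
  u != v -> ~~ e u v ->
  \sum_(y | e v y) f y `^ t <= \sum_(y | e u y) f y `^ t ->
  edge_form e (fun x => f x `^ t) <=
    edge_form e (fun x => (if x == u then f u + f v
                           else if x == v then 0 else f x) `^ t).
Proof.
move=> e_sym e_irr t1 f0 uv euv vu.
rewrite [leRHS](edge_form_perturb (F := fun x => f x `^ t) e_sym e_irr uv euv).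
  rewrite lerDl mulrn_wge0 // eqxx (eq_sym v u) (negbTE uv) eqxx.
  rewrite powR0; last by rewrite gt_eqF // (lt_le_trans _ t1).
  have := powR_superadd t1 (f0 u) (f0 v).
  have := powR_ge0 (f v) t.
  have : 0 <= \sum_(y | e v y) f y `^ t by apply: sumr_ge0 => *; exact: powR_ge0.
  nra.
by move=> x /negbTE-> /negbTE->.
Qed.

(** Induction on the size of the support: [edge_form_shift] empties a vertex as
    long as the support is not a clique. *)
Lemma edge_form_le_phi (R : realType) (T : finType) (e : rel T) (t : R)
    (k : nat) (f : T -> R) :
  symmetric e -> irreflexive e -> 1 <= t ->
  (forall C : {set T}, {in C &, forall x y, x != y -> e x y} -> (#|C| <= k)%N) ->
  (forall x, 0 <= f x) -> \sum_x f x = 1 ->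
  edge_form e (fun x => f x `^ t) <= phi t k.
Proof.
move=> e_sym e_irr t1 cliques.
have [n] := ubnP #|[set x | f x != 0%R]|.
elim: n f => // n IHn f; rewrite ltnS => Sn f0 f1.
set S := [set x | f x != 0] in Sn *.
have [/forall_inP clS|] :=
  boolP [forall x in S, forall y in S, (x != y) ==> e x y].
  apply: edge_form_le_phi_small => //; first exact: lt_le_trans t1.
  apply: cliques => x y xS yS.
  by move/forall_inP: (clS x xS) => /(_ y yS)/implyP.
rewrite negb_forall_in => /exists_inP[u0 u0S].
rewrite negb_forall_in => /exists_inP[v0 v0S].
rewrite negb_imply => /andP[uv0 euv0].
(* Name [u] the vertex with the larger neighbourhood sum. *)
have {u0 v0 u0S v0S uv0 euv0} [u [v [uS vS uv euv le_vu]]] :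
    exists u v, [/\ u \in S, v \in S, u != v, ~~ e u v &
      \sum_(y | e v y) f y `^ t <= \sum_(y | e u y) f y `^ t].
  have [le|/ltW le] := leP (\sum_(y | e v0 y) f y `^ t)
                           (\sum_(y | e u0 y) f y `^ t).
    by exists u0, v0.
  by exists v0, u0; split; rewrite // 1?eq_sym // e_sym.
apply: le_trans (edge_form_shift e_sym e_irr t1 f0 uv euv le_vu) _.
apply: IHn.
- apply: leq_trans Sn; apply: proper_card; apply/properP; split.
    apply/fintype.subsetP => x; rewrite !inE.
    have [->|_] := eqVneq x u; first by move: uS; rewrite inE.
    by case: ifP; rewrite ?eqxx.
  by exists v; rewrite // inE (eq_sym v u) (negbTE uv) !eqxx.
- by move=> x; case: ifP => _; [rewrite addr_ge0 | case: ifP].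
- rewrite -[RHS]f1 [LHS](bigD1 u) //= (bigD1 v) 1?eq_sym //=.
  rewrite [RHS](bigD1 u) //= [X in _ = _ + X](bigD1 v) 1?eq_sym //=.
  rewrite (negbTE uv) !eqxx add0r addrA; congr (_ + _).
  by apply: eq_bigr => x /andP[/negbTE-> /negbTE->].
Qed.

(** * From the largest eigenvalue to the quadratic form *)

(** A nonnegative [M] also covers a matrix without eigenvalues, whose [lambda1]
    is [sup set0 = 0]. *)
Lemma lambda1_le (R : realType) (n : nat) (A : 'M[R]_n) (M : R) :
  0 <= M ->
  (forall x : 'I_n -> R, \sum_i x i ^+ 2 = 1 ->
     \sum_i \sum_j `|A i j| * (`|x i| * `|x j|) <= M) ->
  lambda1 A <= M.
Proof.
move=> M0 leM; rewrite /lambda1.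
have [->|E0] := eqVneq [set a : R | eigenvalue A a]%classic set0.
  by rewrite sup0.
apply: ge_sup; first exact/set0P.
move=> a /= /eigenvalueP[v vA v0].
pose N := \sum_i v ord0 i ^+ 2.
have N_gt0 : 0 < N.
  rewrite lt0r sumr_ge0 ?andbT => [|i _]; last exact: sqr_ge0.
  apply: contra_neq v0 => N0; apply/rowP => i; rewrite mxE.
  apply/eqP; rewrite -sqrf_eq0; apply/eqP.
  by apply: (psumr_eq0P _ N0) => // j _; exact: sqr_ge0.
have sN : Num.sqrt N ^+ 2 = N by rewrite sqr_sqrtr // ltW.
have sN_gt0 : 0 < Num.sqrt N by rewrite sqrtr_gt0.
pose x i := v ord0 i / Num.sqrt N.
have x1 : \sum_i x i ^+ 2 = 1.
  under eq_bigr do rewrite /x exprMn exprVn sN.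
  by rewrite -mulr_suml divff // gt_eqF.
apply: le_trans (leM x x1).
have -> : a = \sum_i \sum_j A i j * (x i * x j).
  rewrite exchange_big /= -[LHS]mulr1 -x1 mulr_sumr; apply: eq_bigr => j _.
  have /rowP/(_ j) := vA; rewrite !mxE => vAj.
  have -> : a * x j ^+ 2 = a * v ord0 j / Num.sqrt N * x j.
    by rewrite /x; ring.
  rewrite -vAj !mulr_suml; apply: eq_bigr => i _; rewrite /x; ring.
apply: ler_sum => i _; apply: ler_sum => j _.
by rewrite -!normrM ler_norm.
Qed.

Lemma clique_number_ordinal (R : realType) (G : network R)
    (C : {set 'I_#|vertex G|}) :
  {in C &, forall i j, i != j -> edge (enum_val i) (enum_val j)} ->
  (#|C| <= clique_number G)%N.
Proof.
move=> clC; pose D : {set vertex G} := [set enum_val i | i in C].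
have -> : #|C| = #|D| by rewrite card_imset //; exact: enum_val_inj.
have clD : is_clique D.
  apply/forall_inP => _ /imsetP[i iC ->].
  apply/forall_inP => _ /imsetP[j jC ->].
  by apply/implyP; rewrite (inj_eq enum_val_inj) => /(clC i j iC jC).
exact: (leq_bigmax_cond (F := fun D : {set vertex G} => #|D|) _ clD).
Qed.

(** * The range 1 < p < 2 *)

(** Restricting the second factor in Hoelder's inequality to the edges is what
    makes the clique number enter. *)
Lemma lambda1_clique_bound (R : realType) (p : R) (G : network R) :
  1 < p < 2 ->
  lambda1 (conductance_mx G) <=
    phi (p / (2 * (p - 1))) (clique_number G) `^ ((p - 1) / p)
      * lp_norm p (conductance_mx G).
Proof.
move=> /andP[p1 p2].
have p0 : 0 < p by lra.
have p10 : 0 < p - 1 by lra.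
pose q := p / (p - 1).
have q0 : 0 < q by rewrite divr_gt0.
have qV : q^-1 = (p - 1) / p by rewrite /q invf_div.
have pq : p^-1 + q^-1 = 1 by rewrite qV mulrBl divff ?gt_eqF // mul1r addrC subrK.
set t := p / (2 * (p - 1)).
have t1 : 1 <= t by rewrite /t ler_pdivlMr; lra.
have qE : q = 2 * t by rewrite /q /t; field; lra.
apply: lambda1_le => [|x x1]; first by rewrite mulr_ge0 ?powR_ge0.
set A := conductance_mx G.
pose e (i j : 'I_#|vertex G|) := edge (enum_val i) (enum_val j).
pose w (ij : 'I_#|vertex G| * 'I_#|vertex G|) :=
  if e ij.1 ij.2 then `|x ij.1| * `|x ij.2| else 0.
have w0 ij : 0 <= w ij by rewrite /w; case: ifP => _; rewrite ?mulr_ge0.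
rewrite pair_big /=.
have -> : \sum_ij `|A ij.1 ij.2| * (`|x ij.1| * `|x ij.2|)
        = \sum_ij `|A ij.1 ij.2| * w ij.
  apply: eq_bigr => -[i j] _ /=; rewrite /w /=; case: ifP => // /negbT eij.
  by rewrite /A mxE conductance_edge // normr0 !mul0r.
apply: le_trans (hoelder_sum p0 q0 pq (fun ij => normr_ge0 (A ij.1 ij.2)) w0) _.
rewrite mulrC /lp_norm pair_big /= qV div1r.
apply: ler_wpM2r; first exact: powR_ge0.
have pow_sq i : `|x i| `^ q = (x i ^+ 2) `^ t.
  by rewrite qE powRrM powR_mulrn // real_normK ?num_real.
have -> : \sum_ij w ij `^ q = edge_form e (fun i => (x i ^+ 2) `^ t).
  rewrite /edge_form; under [RHS]eq_bigr do rewrite big_mkcond.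
  rewrite pair_big /=; apply: eq_bigr => -[i j] _; rewrite /w /=.
  by case: ifP => _; [rewrite powRM // !pow_sq | rewrite powR0 // gt_eqF].
set W := edge_form e _.
have W0 : 0 <= W.
  by apply: sumr_ge0 => i _; apply: sumr_ge0 => j _; rewrite mulr_ge0 ?powR_ge0.
have W_phi : W <= phi t (clique_number G).
  apply: edge_form_le_phi => //.
  - by move=> i j; rewrite /e edge_sym.
  - by move=> i; rewrite /e edge_irr.
  - exact: clique_number_ordinal.
  - by move=> i; exact: sqr_ge0.
apply: ge0_ler_powR; rewrite ?nnegrE //.
- by rewrite divr_ge0 // ltW.
- exact: le_trans W_phi.
Qed.

(** * The range 0 < p <= 1 *)

(** Two distinct coordinates of a unit vector satisfy [x_i^2 + x_j^2 <= 1], so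
    their product is at most 1/2; the diagonal contributes nothing. *)
Lemma lambda1_le_half_sum (R : realType) (n : nat) (A : 'M[R]_n) :
  (forall i, A i i = 0) ->
  lambda1 A <= (\sum_i \sum_j `|A i j|) / 2.
Proof.
move=> A0; apply: lambda1_le => [|x x1].
  by rewrite divr_ge0 // sumr_ge0 // => i _; exact: sumr_ge0.
rewrite mulr_suml; apply: ler_sum => i _; rewrite mulr_suml.
apply: ler_sum => j _.
have [->|ij] := eqVneq i j; first by rewrite A0 normr0 !mul0r.
apply: ler_wpM2l => //.
have : x i ^+ 2 + x j ^+ 2 <= 1.
  rewrite -x1 (bigD1 i) //= (bigD1 j) 1?eq_sym //= addrA lerDl sumr_ge0 //.
  by move=> l _; exact: sqr_ge0.
rewrite -(real_normK (num_real (x i))) -(real_normK (num_real (x j))).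
by have := sqr_ge0 (`|x i| - `|x j|); nra.
Qed.

(** With [S] the half-sum of the [|a_ij|^p], symmetry makes every entry occur
    twice, whence [|a_ij|^p <= S].  Therefore
    [|a_ij| = |a_ij|^p (|a_ij|^p)^(1/p - 1) <= |a_ij|^p S^(1/p - 1)], and summing
    yields [S * S^(1/p - 1) = S^(1/p)]. *)
Lemma sum_le_lp_sum (R : realType) (n : nat) (p : R) (A : 'M[R]_n) :
  0 < p <= 1 -> (forall i j, A i j = A j i) -> (forall i, A i i = 0) ->
  (\sum_i \sum_j `|A i j|) / 2 <=
    ((\sum_i \sum_j `|A i j| `^ p) / 2) `^ p^-1.
Proof.
move=> /andP[p0 p1] A_sym A0.
have p_neq0 : p != 0 by rewrite gt_eqF.
set S := (\sum_i \sum_j `|A i j| `^ p) / 2.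
have row_ge0 i : 0 <= \sum_j `|A i j| `^ p.
  by apply: sumr_ge0 => j _; exact: powR_ge0.
have S0 : 0 <= S by rewrite divr_ge0 // sumr_ge0.
have entry_le i j : `|A i j| `^ p <= S.
  have [<-|ij] := eqVneq i j; first by rewrite A0 normr0 powR0.
  rewrite /S ler_pdivlMr // (bigD1 i) //= [X in _ + X](bigD1 j) 1?eq_sym //=.
  rewrite addrA.
  have -> : `|A i j| `^ p * 2 = `|A i j| `^ p + `|A j i| `^ p.
    by rewrite (A_sym j i); ring.
  rewrite -[leLHS]addr0; apply: lerD; last exact: sumr_ge0.
  apply: lerD.
    by rewrite (bigD1 j) //= lerDl sumr_ge0 // => l _; exact: powR_ge0.
  by rewrite (bigD1 i) //= lerDl sumr_ge0 // => l _; exact: powR_ge0.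
have norm_le i j : `|A i j| <= `|A i j| `^ p * S `^ (p^-1 - 1).
  have [->|Aij] := eqVneq (A i j) 0; first by rewrite normr0 powR0 // mul0r.
  have E : `|A i j| = `|A i j| `^ p * (`|A i j| `^ p) `^ (p^-1 - 1).
    rewrite -powRrM -powRD; last by rewrite normr_eq0 Aij implybT.
    by rewrite mulrBr mulr1 divff // addrC subrK powRr1.
  rewrite [leLHS]E; apply: ler_wpM2l; first exact: powR_ge0.
  apply: ge0_ler_powR; rewrite ?nnegrE ?powR_ge0 //.
  by rewrite subr_ge0 invf_ge1.
apply: (@le_trans _ _ (S * S `^ (p^-1 - 1))).
  rewrite /S mulrAC ler_pM2r ?invr_gt0 // mulr_suml.
  apply: ler_sum => i _; rewrite mulr_suml; apply: ler_sum => j _.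
  exact: norm_le.
by rewrite mulr_powRB1 ?invr_gt0.
Qed.

Lemma lambda1_edge_bound (R : realType) (p : R) (G : network R) :
  0 < p <= 1 ->
  lambda1 (conductance_mx G) <=
    2 `^ (- (1 / p)) * lp_norm p (conductance_mx G).
Proof.
move=> p01.
have A0 i : conductance_mx G i i = 0.
  by rewrite mxE conductance_edge // edge_irr.
have A_sym i j : conductance_mx G i j = conductance_mx G j i.
  by rewrite !mxE conductance_sym.
apply: le_trans (lambda1_le_half_sum A0) _.
apply: le_trans (sum_le_lp_sum p01 A_sym A0) _.
rewrite /lp_norm div1r mulrC powRM ?invr_ge0 //; last first.
  by apply: sumr_ge0 => i _; apply: sumr_ge0 => j _; exact: powR_ge0.
by rewrite -[2^-1]powR_inv1 // -powRrM mulN1r.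
Qed.

Theorem proposition3p1 (R : realType) (p : R) :
  (1 < p < 2 ->
    forall k : nat, (2 <= k)%N ->
    forall G : network R, clique_number G = k ->
    lambda1 (conductance_mx G) <=
      phi (p / (2 * (p - 1))) k `^ ((p - 1) / p) * lp_norm p (conductance_mx G))
  /\
  (0 < p <= 1 ->
    forall G : network R,
    lambda1 (conductance_mx G) <=
      2 `^ (- (1 / p)) * lp_norm p (conductance_mx G)).
Proof.
split=> [p12 k _ G <-|p01 G]; first exact: lambda1_clique_bound.
exact: lambda1_edge_bound.
Qed.
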